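(* Let $\theta^0,\theta^1,\theta^\infty_1,\theta^\infty_2,\theta^\infty_3\in\mathbb{C}$ with $2\theta^0+2\theta^1+2\theta^\infty_1+\theta^\infty_2+\theta^\infty_3=0$, $\theta^0\neq0$, $\theta^1\ne0$ and $\theta^\infty_2\neq\theta^\infty_3$. Let $q_1,p_1,q_2,p_2,v$ be holomorphic functions of $t$ and $U$ a holomorphic $2\times2$-matrix function of $t$ on a domain of $\mathbb{C}\setminus\{0\}$, with $v\ne0$ and $\det U\neq0$. Put $$Q=\begin{pmatrix} q_1&1\\ -q_2&q_1\end{pmatrix},\quad P=\begin{pmatrix} p_1/2&-p_2\\ p_2q_2-\theta^0-\theta^1-\theta^\infty_1-\theta^\infty_2&p_1/2\end{pmatrix},\quad \Theta=\begin{pmatrix}\theta^\infty_2&0\\ 0&\theta^\infty_3\end{pmatrix},\quad G=\mathrm{diag}(1,v)\oplus U,$$ assume $\det Q=q_1^2+q_2\neq0$, and in $2\times2$ blocks (scalars meaning multiples of $I=I_2$) put $$A_\infty=\begin{pmatrix}O&O\\ O&-tI\end{pmatrix},\quad \hat A_0^{(0)}=\begin{pmatrix}QP+\theta^0+\theta^\infty_1\\ tI\end{pmatrix}\begin{pmatrix}I-Q&\frac1t\left\{(Q-I)QP+(\theta^0+\theta^\infty_1)Q-\theta^\infty_1\right\}\end{pmatrix},$$ $$\hat A_1^{(0)}=\begin{pmatrix}(QP+\theta^0+\theta^\infty_1)(Q-I)-\Theta\\ tQ\end{pmatrix}\begin{pmatrix}I&\frac1t\left\{(QP+\theta^0+\theta^1+\theta^\infty_1+\Theta)Q^{-1}-QP-\theta^0-\theta^\infty_1\right\}\end{pmatrix},$$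 $$\hat B_1=\frac1t\begin{pmatrix}O&[\hat A_0^{(0)}+\hat A_1^{(0)}]_{12}\\ [\hat A_0^{(0)}+\hat A_1^{(0)}]_{21}&O\end{pmatrix},$$ where $[\,\cdot\,]_{ij}$ is the $(i,j)$ block. Consider the linear systems $$\frac{\partial Y}{\partial x}=AY,\quad A=A_\infty+G^{-1}\left(\frac{\hat A_0^{(0)}}{x}+\frac{\hat A_1^{(0)}}{x-1}\right)G,\qquad \frac{\partial Y}{\partial t}=BY,\quad B=-\begin{pmatrix}O&O\\ O&I\end{pmatrix}x+G^{-1}\hat B_1G .$$ Then the compatibility condition $\partial_tA-\partial_xB+[A,B]=O$ (for all $x$) is equivalent to the Hamiltonian system $\frac{dq_i}{dt}=\frac{\partial H}{\partial p_i}$, $\frac{dp_i}{dt}=-\frac{\partial H}{\partial q_i}$ $(i=1,2)$ with $$tH=\mathrm{tr}\left[Q(Q-1)P(P+t)+(\theta^0-\theta^1)QP+\theta^1P+(\theta^0+\theta^\infty_1)tQ\right],$$ together with $$t\frac{dU}{dt}=\begin{pmatrix}tq_1-\theta^\infty_1+\theta^\infty_2+1&t\\ -tq_2&2p_1q_1+3tq_1-p_1+2p_2q_2-2q_1p_2(q_1-1)-\eta-t\end{pmatrix}U,$$ $$\frac tv\frac{dv}{dt}=(2q_1-1)p_1-2q_1p_2(q_1-1)+2tq_1+2p_2q_2-t+\theta^0-\theta^1,$$ where $\eta=\theta^0+3\theta^1+3\theta^\infty_1+\theta^\infty_2-1$.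
   Context: This is the fifth matrix Painlevé system $H^{\mathrm{Mat}}_{\mathrm{V}}$, attached to linear systems with regular singularities at $x=0,1$ and an irregular singularity at $x=\infty$, of spectral type $(2)(11),22,22$. $H$ is regarded as a function of $q_1,p_1,q_2,p_2,t$ by inserting the displayed matrices. $\oplus$ denotes block-diagonal sum. *)

(* Defs.v *)
From mathcomp Require Import all_boot all_order all_algebra.
From mathcomp Require Import all_classical all_reals all_analysis.
From mathcomp Require Import complex.

Set Implicit Arguments.
Unset Strict Implicit.
Unset Printing Implicit Defensive.

Import Order.TTheory GRing.Theory Num.Theory.
Import numFieldNormedType.Exports.

Local Open Scope ring_scope.
Local Open Scope classical_set_scope.

(* MathComp-Analysis puts a topology and a norm on every numFieldType, but not
   on the bare type R[i]; going through this structure makes them available. *)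
Definition Cplx (R : realType) : numFieldType := R[i].

Section Analysis.
Context {K : numFieldType}.

Definition domain (D : set K) : Prop := [/\ open D, connected D & D !=set0].

(* Meant for open D, where it is complex differentiability at each point. *)
Definition holomorphic_on (V : normedModType K) (D : set K) (f : K -> V) : Prop :=
  forall t, D t -> derivable f t 1.

(* d_t A - d_x B + [A, B] at the point (x, t). *)
Definition zero_curvature (A B : K -> K -> 'M[K]_(2 + 2)) (x t : K) :
    'M[K]_(2 + 2) :=
  derive1 (fun s => A x s) t - derive1 (fun y => B y t) x
    + (A x t *m B x t - B x t *m A x t).

End Analysis.

Section LaxPair.
Context {K : fieldType}.

Definition mx22 (a b c d : K) : 'M[K]_2 :=
  \matrix_(i, j) if i == 0 then if j == 0 then a else b
                 else if j == 0 then c else d.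

Definition Qmx (q1 q2 : K) : 'M[K]_2 := mx22 q1 1 (- q2) q1.

(* thk stands for theta^k and thik for theta^infty_k. *)
Context (th0 th1 thi1 thi2 thi3 : K).

Definition Pmx (p1 q2 p2 : K) : 'M[K]_2 :=
  mx22 (p1 / 2) (- p2) (p2 * q2 - th0 - th1 - thi1 - thi2) (p1 / 2).

Definition Thetamx : 'M[K]_2 := mx22 thi2 0 0 thi3.

Definition Gmx (v : K) (U : 'M[K]_2) : 'M[K]_(2 + 2) := block_mx (mx22 1 0 0 v) 0 0 U.

Definition Ainf (t : K) : 'M[K]_(2 + 2) := block_mx 0 0 0 (- t)%:M.

Definition A0hat (q1 p1 q2 p2 t : K) : 'M[K]_(2 + 2) :=
  let Q := Qmx q1 q2 in let P := Pmx p1 q2 p2 in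
  col_mx (Q *m P + (th0 + thi1)%:M) t%:M *m
  row_mx (1%:M - Q)
    (t^-1 *: ((Q - 1%:M) *m Q *m P + (th0 + thi1) *: Q - thi1%:M)).

Definition A1hat (q1 p1 q2 p2 t : K) : 'M[K]_(2 + 2) :=
  let Q := Qmx q1 q2 in let P := Pmx p1 q2 p2 in
  col_mx ((Q *m P + (th0 + thi1)%:M) *m (Q - 1%:M) - Thetamx) (t *: Q) *m
  row_mx 1%:M
    (t^-1 *: ((Q *m P + (th0 + th1 + thi1)%:M + Thetamx) *m invmx Q
                - Q *m P - (th0 + thi1)%:M)).

Definition B1hat (q1 p1 q2 p2 t : K) : 'M[K]_(2 + 2) :=
  let S := A0hat q1 p1 q2 p2 t + A1hat q1 p1 q2 p2 t in
  t^-1 *: block_mx 0 (ursubmx S) (dlsubmx S) 0.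

Definition Amx (q1 p1 q2 p2 v : K) (U : 'M[K]_2) (x t : K) : 'M[K]_(2 + 2) :=
  let G := Gmx v U in
  Ainf t + invmx G *m (x^-1 *: A0hat q1 p1 q2 p2 t
                       + (x - 1)^-1 *: A1hat q1 p1 q2 p2 t) *m G.

Definition Bmx (q1 p1 q2 p2 v : K) (U : 'M[K]_2) (x t : K) : 'M[K]_(2 + 2) :=
  let G := Gmx v U in
  - (x *: block_mx 0 0 0 1%:M) + invmx G *m B1hat q1 p1 q2 p2 t *m G.

Definition Ham (q1 p1 q2 p2 t : K) : K :=
  let Q := Qmx q1 q2 in let P := Pmx p1 q2 p2 in
  t^-1 * \tr (Q *m (Q - 1%:M) *m P *m (P + t%:M) + (th0 - th1) *: (Q *m P)
              + th1 *: P + ((th0 + thi1) * t) *: Q).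

End LaxPair.

(* Main.v *)
Require Import Defs.
From mathcomp Require Import all_boot all_order all_algebra.
From mathcomp Require Import all_classical all_reals all_analysis.
From mathcomp Require Import perm ring.

Set Implicit Arguments.
Unset Strict Implicit.
Unset Printing Implicit Defensive.

Import GRing.Theory Num.Theory.
Import numFieldNormedType.Exports.

Local Open Scope ring_scope.
Local Open Scope classical_set_scope.

(** Conjugation by [G] removes it from the poles of [A]; all that remains of it
    in the compatibility condition is the block-diagonal matrix
    [Om = G' G^-1 = diag(0, v'/v) + U' U^-1].  The terms constant in [x] cancel
    by the choice of [B1hat], so the condition splits, pole by pole, into Lax
    equations for the two residues,
      [A0' = [X, A0]],  [A1' = [X - E, A1]],
    with [X = B1hat + Om] and [E = diag(0, I)]
    ([curvature_gauged], [zero_curvature_residues]).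

    Put [M = Q P + th0 + thi1].  The shape of [P] together with the trace
    condition on the exponents is the commutation relation
    [P Q - Q P = Theta + th0 + th1 + thi1] ([comm_PmxQmx]), so that
    [(Q P + th0 + th1 + thi1 + Theta) Q^-1] is just [P].  Hence the residues
    factor as [A0 = L0 R0] and [A1 = L1 R1] with [R0 L0 = th0] and
    [R1 L1 = th1].  Since these eigenvalues are constant and nonzero, a Lax
    equation for [L R] is the same as a pair of linear equations for [L] and
    [R], up to a gauge matrix ([isomonodromic_factor]).  Comparing blocks
    eliminates the gauge matrices and leaves
      [t V = t W + 1 + t Q + Theta - thi1],
      [t Q' = t [W, Q] + F(Q, P)],  [t P' = t [W, P] + G(Q, P)],
    where [W = diag(0, v'/v)] and [V = U' U^-1]
    ([residues_matrix_painleve]).  Granted the commutation relation, this is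
    algebra in noncommuting variables, valid for matrices of every size.

    Entries matter only at the end ([matrix_painleve_entries]).  The entry
    [(1, 2)] of [Q] is the constant [1], which forces the value of [v'/v]; the
    equation for [V] is then the one for [U], and the remaining entries are the
    partial derivatives of [H] ([dHam_dp1], [dHam_dq1], [dHam_dp2],
    [dHam_dq2]). *)

(** * Derivatives of matrix-valued functions *)

Section MatrixDerivative.
Context {K : numFieldType}.

(** A matrix function is the finite sum of its entries times the elementary
    matrices, so entrywise derivability suffices; conversely taking an entry is
    continuous and linear. *)
Lemma is_derive_mxP m n (F : K -> 'M[K]_(m, n)) (t : K) (dF : 'M[K]_(m, n)) :
  is_derive t 1 F dF <->
  forall i j, is_derive t 1 (fun s => F s i j) (dF i j).
Proof.
have coordP (G : K -> 'M[K]_(m, n)) : derivable G t 1 ->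
    forall i j, is_derive t 1 (fun s => G s i j) ('D_1 G t i j).
  move=> dG i j.
  have dGc : (fun h => h^-1 *: (((fun s => G s i j) \o shift t) (h *: 1) - G t i j))
      @ 0^' --> 'D_1 G t i j.
    have -> : (fun h => h^-1 *: (((fun s => G s i j) \o shift t) (h *: 1) - G t i j))
      = (fun M : 'M[K]_(m, n) => M i j) \o
        (fun h => h^-1 *: ((G \o shift t) (h *: 1) - G t)).
      by apply/funext => h /=; rewrite !mxE.
    apply: (@cvg_comp _ _ _ _ _ _ (nbhs ('D_1 G t))); first exact: dG.
    exact: (@coord_continuous K m n i j).
  by apply: DeriveDef; [exact: cvgP dGc | exact/cvg_lim].
split=> [[dF' <-]|dF']; first exact: coordP.
have dF1 : derivable F t 1.
  have -> : F = \sum_(i < m) \sum_(j < n) (fun s => F s i j *: delta_mx i j).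
    apply/funext => s; rewrite fct_sumE {1}[F s]matrix_sum_delta.
    by apply: eq_bigr => i _; rewrite fct_sumE.
  apply/derivable1_diffP; apply: differentiable_sum => i.
  apply: differentiable_sum => j; apply: differentiableZl.
  exact/derivable1_diffP/(ex_derive (is_derive := dF' i j)).
apply: DeriveDef => //; apply/matrixP => i j.
by rewrite -(derive_val (is_derive := coordP _ dF1 i j))
  (derive_val (is_derive := dF' i j)).
Qed.

Lemma is_derive_ext {V : normedModType K} (F : K -> V) (t : K) (dF dF' : V) :
  is_derive t 1 F dF -> dF = dF' -> is_derive t 1 F dF'.
Proof. by move=> ? <-. Qed.

Lemma is_derive_mul (f g : K -> K) (t df dg : K) :
  is_derive t 1 f df -> is_derive t 1 g dg ->
  is_derive t 1 (fun s => f s * g s) (df * g t + f t * dg).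
Proof.
move=> hf hg; apply: (is_derive_ext (is_deriveM hf hg)).
by rewrite addrC mulrC.
Qed.

Lemma is_derive_add {V : normedModType K} (f g : K -> V) (t : K) (df dg : V) :
  is_derive t 1 f df -> is_derive t 1 g dg ->
  is_derive t 1 (fun s => f s + g s) (df + dg).
Proof. exact: is_deriveD. Qed.

Lemma is_derive_opp {V : normedModType K} (f : K -> V) (t : K) (df : V) :
  is_derive t 1 f df -> is_derive t 1 (fun s => - f s) (- df).
Proof. exact: is_deriveN. Qed.

Lemma is_derive_const {V : normedModType K} (c : V) (t : K) :
  is_derive t 1 (fun=> c) 0.
Proof. exact: is_derive_cst. Qed.

(** The scalar case of [is_derive_const], in a form from which the codomain can
    be inferred. *)
Lemma is_derive_constK (c t : K) : is_derive t 1 (fun=> c : K) 0.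
Proof. exact: is_derive_const. Qed.

Lemma is_derive_derive1 {V : normedModType K} (f : K -> V) (t : K) (df : V) :
  is_derive t 1 f df -> derive1 f t = df.
Proof. by move=> hf; rewrite derive1E derive_val. Qed.

Lemma is_derive_var (t : K) : is_derive t 1 (fun s => s) 1.
Proof. exact: is_derive_id. Qed.

Lemma is_derive_inv (f : K -> K) (t df : K) : f t != 0 ->
  is_derive t 1 f df ->
  is_derive t 1 (fun s => (f s)^-1) (- (f t) ^- 2 * df).
Proof.
move=> ft0 hf; apply: DeriveDef; first exact: derivableV.
by rewrite deriveV// derive_val.
Qed.

Lemma is_derive_bigsum {V : normedModType K} (I : Type) (r : seq I) (P : pred I)
    (f : I -> K -> V) (t : K) (df : I -> V) :
  (forall i, is_derive t 1 (f i) (df i)) ->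
  is_derive t 1 (fun s => \sum_(i <- r | P i) f i s) (\sum_(i <- r | P i) df i).
Proof.
move=> hf; elim: r => [|i r IHr].
  by rewrite big_nil; under eq_fun do rewrite big_nil; exact: is_derive_const.
rewrite big_cons; under eq_fun do rewrite big_cons.
by case: (P i) => //; exact: is_derive_add.
Qed.

Lemma derivable_bigprod (I : Type) (r : seq I) (P : pred I)
    (f : I -> K -> K) (t : K) :
  (forall i, derivable (f i) t 1) ->
  derivable (fun s => \prod_(i <- r | P i) f i s) t 1.
Proof.
move=> hf; elim: r => [|i r IHr].
  by under eq_fun do rewrite big_nil; exact: derivable_cst.
under eq_fun do rewrite big_cons.
by case: (P i) => //; exact: derivableM.
Qed.

Lemma is_derive_mulmx m n p (F : K -> 'M[K]_(m, n)) (G : K -> 'M[K]_(n, p))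
    (t : K) dF dG :
  is_derive t 1 F dF -> is_derive t 1 G dG ->
  is_derive t 1 (fun s => F s *m G s) (dF *m G t + F t *m dG).
Proof.
move=> /is_derive_mxP hF /is_derive_mxP hG; apply/is_derive_mxP => i j.
rewrite !mxE -big_split; under eq_fun do rewrite mxE.
by apply: is_derive_bigsum => k; exact: is_derive_mul.
Qed.

Lemma is_derive_scalemx m n (f : K -> K) (F : K -> 'M[K]_(m, n)) (t : K) df dF :
  is_derive t 1 f df -> is_derive t 1 F dF ->
  is_derive t 1 (fun s => f s *: F s) (df *: F t + f t *: dF).
Proof.
move=> hf /is_derive_mxP hF; apply/is_derive_mxP => i j.
by rewrite !mxE; under eq_fun do rewrite mxE; exact: is_derive_mul.
Qed.

Lemma is_derive_scalar_mx n (f : K -> K) (t : K) df :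
  is_derive t 1 f df -> is_derive t 1 (fun s => (f s)%:M : 'M[K]_n) df%:M.
Proof.
move=> hf; apply/is_derive_mxP => i j; rewrite mxE.
under eq_fun do rewrite mxE.
by case: (i == j); rewrite ?mulr1n ?mulr0n //; exact: is_derive_const.
Qed.

Lemma is_derive_row_mx m n1 n2 (F : K -> 'M[K]_(m, n1)) (G : K -> 'M[K]_(m, n2))
    (t : K) dF dG :
  is_derive t 1 F dF -> is_derive t 1 G dG ->
  is_derive t 1 (fun s => row_mx (F s) (G s)) (row_mx dF dG).
Proof.
move=> /is_derive_mxP hF /is_derive_mxP hG; apply/is_derive_mxP => i j.
by rewrite mxE; under eq_fun do rewrite mxE; case: (fintype.split j).
Qed.

Lemma is_derive_col_mx m1 m2 n (F : K -> 'M[K]_(m1, n)) (G : K -> 'M[K]_(m2, n))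
    (t : K) dF dG :
  is_derive t 1 F dF -> is_derive t 1 G dG ->
  is_derive t 1 (fun s => col_mx (F s) (G s)) (col_mx dF dG).
Proof.
move=> /is_derive_mxP hF /is_derive_mxP hG; apply/is_derive_mxP => i j.
by rewrite mxE; under eq_fun do rewrite mxE; case: (fintype.split i).
Qed.

Lemma is_derive_mx22 (a b c d : K -> K) (t da db dc dd : K) :
  is_derive t 1 a da -> is_derive t 1 b db ->
  is_derive t 1 c dc -> is_derive t 1 d dd ->
  is_derive t 1 (fun s => mx22 (a s) (b s) (c s) (d s)) (mx22 da db dc dd).
Proof.
move=> ha hb hc hd; apply/is_derive_mxP => i j.
by rewrite mxE; under eq_fun do rewrite mxE; case: (i == 0); case: (j == 0).
Qed.

Lemma derivable_det n (F : K -> 'M[K]_n) (t : K) :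
  derivable F t 1 -> derivable (fun s => \det (F s)) t 1.
Proof.
move=> /derivableP /is_derive_mxP hF.
have hM (s : 'S_n) :
    derivable (fun u => (-1) ^+ s * \prod_i F u i (s i)) t 1.
  apply: derivableM; first exact: derivable_cst.
  by apply: derivable_bigprod => i; case: (hF i (s i)).
have hS := is_derive_bigsum (index_enum _) xpredT (fun s => derivableP (hM s)).
by case: hS.
Qed.

(** Cramer's rule gives the derivability of the inverse; the value is then
    forced by differentiating [F *m invmx F = 1]. *)
Lemma is_derive_invmx n (F : K -> 'M[K]_n) (t : K) dF :
  (\forall s \near t, F s \in unitmx) -> is_derive t 1 F dF ->
  is_derive t 1 (fun s => invmx (F s)) (- (invmx (F t) *m dF *m invmx (F t))).
Proof.
move=> uF hF; have uFt := nbhs_singleton uF.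
have dI : derivable (fun s => invmx (F s)) t 1.
  apply: (near_eq_derivable (f := fun s => (\det (F s))^-1 *: \adj (F s))).
    by near=> s; rewrite /invmx ifT//; near: s.
  have hdet : derivable (fun s => (\det (F s))^-1) t 1.
    apply: derivableV; first by rewrite -unitfE -unitmxE.
    by apply: derivable_det; case: hF.
  have hadj : is_derive t 1 (fun s => \adj (F s))
      (\matrix_(i, j) 'D_1 (fun s => \adj (F s) i j) t).
    apply/is_derive_mxP => i j; rewrite mxE; apply/derivableP.
    under eq_fun do rewrite mxE.
    apply: derivableM; first exact: derivable_cst.
    apply: derivable_det.
    have hsub : is_derive t 1 (fun s => row' j (col' i (F s)))
        (row' j (col' i dF)).
      apply/is_derive_mxP => k l; rewrite 2!mxE.
      under eq_fun do rewrite 2!mxE.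
      by move/is_derive_mxP : hF; apply.
    by case: hsub.
  by case: (is_derive_scalemx (derivableP hdet) hadj).
move/derivableP: (dI); set dFi := 'D_1 _ t => hI.
apply: (is_derive_ext hI).
have h1 := is_derive_mulmx hF hI.
have h0 : is_derive t 1 (fun s => F s *m invmx (F s)) 0.
  apply: (near_eq_is_derive (f := fun=> 1%:M)).
  by near=> s; rewrite mulmxV//; near: s.
move: (derive_val (is_derive := h1)); rewrite (derive_val (is_derive := h0)).
move=> /(congr1 (mulmx (invmx (F t)))).
rewrite mulmx0 mulmxDr mulKmx// mulmxA => /esym /eqP.
by rewrite addrC addr_eq0 => /eqP.
Unshelve. all: by end_near. Qed.

End MatrixDerivative.

(** * Noncommutative identities between matrices *)

Section MatrixRing.
Context {K : fieldType}.

(* The rules below restate library facts over a [fieldType], so that rewriting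
   with them always yields the same instances of the matrix operations and the
   resulting entries are recognised as equal atoms by [ring] and [field]. *)

Lemma addmxE m n (A B : 'M[K]_(m, n)) i j : (A + B) i j = A i j + B i j.
Proof. by rewrite mxE. Qed.

Lemma oppmxE m n (A : 'M[K]_(m, n)) i j : (- A) i j = - A i j.
Proof. by rewrite mxE. Qed.

Lemma scalemxE m n (a : K) (A : 'M[K]_(m, n)) i j : (a *: A) i j = a * A i j.
Proof. by rewrite mxE. Qed.

Lemma scalar_mxE n (a : K) i j : (a%:M : 'M[K]_n) i j = a * (i == j)%:R.
Proof. by rewrite mxE mulr_natr. Qed.

Lemma zeromxE m n i j : (0 : 'M[K]_(m, n)) i j = 0.
Proof. by rewrite mxE. Qed.

Lemma mulmxNl m n p (A : 'M[K]_(m, n)) (B : 'M[K]_(n, p)) :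
  (- A) *m B = - (A *m B).
Proof. exact: mulNmx. Qed.

Lemma mulmxNr m n p (A : 'M[K]_(m, n)) (B : 'M[K]_(n, p)) :
  A *m (- B) = - (A *m B).
Proof. exact: mulmxN. Qed.

Lemma mulmxZl m n p (a : K) (A : 'M[K]_(m, n)) (B : 'M[K]_(n, p)) :
  (a *: A) *m B = a *: (A *m B).
Proof. by rewrite scalemxAl. Qed.

Lemma mulmxZr m n p (a : K) (A : 'M[K]_(m, n)) (B : 'M[K]_(n, p)) :
  A *m (a *: B) = a *: (A *m B).
Proof. by rewrite scalemxAr. Qed.

Definition mx_distr := (@mulmxDl K, @mulmxDr K, mulmxNl, mulmxNr,
  mulmxZl, mulmxZr, @mul0mx K, @mulmx0 K, @mul_scalar_mx K, @mul_mx_scalar K, @mulmxA K).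

Definition mx_entry := (addmxE, oppmxE, scalemxE, scalar_mxE, zeromxE).

Lemma mx_ext m n (A B : 'M[K]_(m, n)) :
  (forall i j, A i j = B i j :> K) -> A = B.
Proof. by move=> AB; apply/matrixP. Qed.

End MatrixRing.

(** After distributing, both sides are linear combinations of words in the
    matrices; entrywise these words are atoms of a commutative identity. *)
Ltac mx_field := rewrite ?mx_distr; apply: mx_ext => i j; rewrite ?mx_entry; field.
Ltac mx_ring := rewrite ?mx_distr; apply: mx_ext => i j; rewrite ?mx_entry; ring.

Lemma eq_add (V : zmodType) (a b c d : V) : a = b -> c = d -> a + c = b + d.
Proof. by move=> -> ->. Qed.

Lemma eq_from_sub (V : zmodType) (a b c d : V) :
  c = d -> a - b = c - d -> a = b.
Proof. by move=> -> /eqP; rewrite subrr subr_eq0 => /eqP. Qed.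

(** Proves an equality that is the linear combination [e] of known ones. *)
Ltac mx_lin e := apply: (eq_from_sub e); by mx_field.

(** Here [L *m R] has the eigenvalue [th] on the image of [L], and
    [dR *m L + R *m dL = 0] says that [th] is constant.  Multiplying the Lax
    equation by [L] on the right shows that [dL - X *m L] is in the
    [th]-eigenspace, hence, as [th != 0], of the form [- L *m k]; multiplying
    what is left by [R] on the left gives [dR]. *)
Lemma isomonodromic_factor (K : fieldType) m n (L dL : 'M[K]_(m, n))
    (R dR : 'M[K]_(n, m)) (X : 'M[K]_m) (th : K) :
  th != 0 -> R *m L = th%:M -> dR *m L + R *m dL = 0 ->
  dL *m R + L *m dR = X *m (L *m R) - L *m R *m X <->
  exists k : 'M[K]_n, dL = X *m L - L *m k /\ dR = k *m R - R *m X.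
Proof.
move=> th0 RL dRL; split=> [lax|[k [-> ->]]]; last by mx_ring.
have laxL : th *: (dL - X *m L) = L *m (R *m (dL - X *m L)).
  have e1 : dL *m (R *m L) + L *m (dR *m L) = X *m L *m (R *m L) - L *m R *m X *m L.
    by rewrite !mulmxA -!mulmxDl lax; mx_ring.
  have e2 : L *m (dR *m L) = - (L *m (R *m dL)).
    by apply/eqP; rewrite -addr_eq0 -mulmxDr dRL mulmx0.
  rewrite e2 RL in e1; mx_lin e1.
pose k := - th^-1 *: (R *m (dL - X *m L)).
have dLE : dL = X *m L - L *m k.
  rewrite /k -scalemxAr -laxL scalerA mulNr mulVf// scaleN1r opprK.
  by rewrite addrC subrK.
exists k; split=> //; apply: subr0_eq.
have : L *m (dR - (k *m R - R *m X)) = 0.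
  rewrite dLE in lax; mx_lin lax.
move=> /(congr1 (mulmx R)); rewrite mulmxA RL mul_scalar_mx mulmx0.
by move/eqP; rewrite scaler_eq0 (negPf th0) => /eqP.
Qed.

(** * From the Lax equations to a matrix Painleve system *)

Section MatrixPainleve.
Context {K : fieldType} {n : nat}.
(* [M] and [dM] are variables, tied to [Q], [P], [dQ], [dP] only by hypotheses:
   the identities below stay short as long as [M] is not expanded. *)
Variables (th0 th1 thi1 t : K) (Theta Q P M dQ dP dM W V b : 'M[K]_n).
Hypotheses (t0 : t != 0) (th0_neq0 : th0 != 0) (th1_neq0 : th1 != 0).
Hypothesis QP : Q *m P = M - (th0 + thi1)%:M.
Hypothesis dQP : dQ *m P + Q *m dP = dM.
Hypothesis comm_PQ : P *m Q = M + Theta + th1%:M.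
Hypothesis dcomm_PQ : dP *m Q + P *m dQ = dM.

Local Notation Z := ((Q - 1%:M) *m M + th0%:M).
Local Notation T := (M *m (Q - 1%:M) - Theta).
Local Notation N := (P - M).

Local Notation L0 := (col_mx M t%:M).
Local Notation R0 := (row_mx (1%:M - Q) (t^-1 *: Z)).
Local Notation dL0 := (col_mx dM 1%:M).
Local Notation dR0 := (row_mx (- dQ)
  (t^-1 *: (dQ *m M + (Q - 1%:M) *m dM) - t ^- 2 *: Z)).

Local Notation L1 := (col_mx T (t *: Q)).
Local Notation R1 := (row_mx 1%:M (t^-1 *: N)).
Local Notation dL1 := (col_mx (dM *m (Q - 1%:M) + M *m dQ) (Q + t *: dQ)).
Local Notation dR1 := (row_mx (0 : 'M[K]_n) (t^-1 *: (dP - dM) - t ^- 2 *: N)).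

Hypothesis bE : t *: b = M *m (t^-1 *: Z) + T *m (t^-1 *: N).
Local Notation X := (block_mx W b 1%:M V).
Local Notation E := (block_mx 0 0 0 1%:M : 'M[K]_(n + n)).

Lemma R0L0 : R0 *m L0 = th0%:M.
Proof. by rewrite mul_row_col; mx_field. Qed.

Lemma R1L1 : R1 *m L1 = th1%:M.
Proof. by rewrite mul_row_col; mx_lin comm_PQ. Qed.

Lemma dR0L0 : dR0 *m L0 + R0 *m dL0 = 0.
Proof. by rewrite !mul_row_col; mx_field. Qed.

Lemma dR1L1 : dR1 *m L1 + R1 *m dL1 = 0.
Proof. by rewrite !mul_row_col; mx_lin dcomm_PQ. Qed.

(** The terms quadratic in [M] cancel. *)
Lemma X12E : (t * t) *: b = th0 *: M + M *m (Q - 1%:M) *m P - Theta *m N.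
Proof. by mx_lin (congr1 ( *:%R t) bE). Qed.

Local Notation F := (M *m Q + Q *m M - M - M + (th0 + thi1)%:M - Theta
  + t *: (Q *m (Q - 1%:M)) + (Theta - thi1%:M) *m Q).
Local Notation G := (P *m P - P *m M - M *m P + t *: (P - M)
  - P *m (t *: Q + Theta - thi1%:M)).

(** The lower blocks of the equations for [L0] and [L1], and the left blocks of
    those for [R0] and [R1], determine the gauge matrices, [V] and [dQ]; the
    other blocks for [L0] and [R1] determine [dM] and [dP - dM], whence [dP].
    The remaining blocks follow from the constancy of [R0 *m L0] and
    [R1 *m L1]. *)
Lemma residues_matrix_painleve :
  (dL0 *m R0 + L0 *m dR0 = X *m (L0 *m R0) - L0 *m R0 *m X /\
   dL1 *m R1 + L1 *m dR1 = (X - E) *m (L1 *m R1) - L1 *m R1 *m (X - E)) <->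
  [/\ t *: V = t *: W + (1%:M + t *: Q + Theta - thi1%:M),
      t *: dQ = t *: (W *m Q - Q *m W) + F
    & t *: dP = t *: (W *m P - P *m W) + G].
Proof.
have XE : X - E = block_mx W b 1%:M (V - 1%:M).
  by rewrite opp_block_mx add_block_mx !oppr0 !addr0.
rewrite (isomonodromic_factor _ th0_neq0 R0L0 dR0L0).
rewrite (isomonodromic_factor _ th1_neq0 R1L1 dR1L1) {}XE.
rewrite !mul_block_col !mul_row_block.
split.
- move=> [[k [+ +]] [h [+ +]]].
  rewrite !mul_col_mx !mul_mx_row !opp_col_mx !opp_row_mx !add_col_mx !add_row_mx.
  move=> /eq_col_mx[eM eV] /eq_row_mx[eQ _] /eq_col_mx[_ eQ'] /eq_row_mx[eh eN].
  have kE : k = V + t^-1 *: (M - 1%:M).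
    by move/(congr1 ( *:%R t^-1)): eV => eV; mx_lin eV.
  have hE : h = W + t^-1 *: N by mx_lin (esym eh).
  (* In the sum of the equations for [t *: dQ] from [R0] and from [L1], the
     derivative and the terms in [Q *m W] cancel. *)
  have VE : t *: V = t *: W + (1%:M + t *: Q + Theta - thi1%:M).
    rewrite kE hE in eQ eQ'.
    mx_lin (eq_add QP (eq_add (congr1 ( *:%R t) (esym eQ)) (esym eQ'))).
  have {}kE : t *: k = t *: W + t *: Q + Theta - thi1%:M + M.
    by rewrite kE scalerDr VE; mx_field.
  rewrite {}hE in eQ' eN.
  split=> //.
  + mx_lin (eq_add eQ' (eq_add (congr1 (mulmx^~ Q) VE) (esym QP))).
  (* In this combination of the equations for [dM] and [dP - dM] the block [b]
     cancels. *)
  + mx_lin (eq_add (congr1 ( *:%R t) (eq_add eM (congr1 ( *:%R t) eN)))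
      (eq_add (congr1 (mulmx M) (esym kE)) (congr1 (mulmx N) (esym VE)))).
- move=> [VE eQ eP].
  pose k := V + t^-1 *: (M - 1%:M); pose h := W + t^-1 *: N.
  have kE : t *: k = t *: W + t *: Q + Theta - thi1%:M + M.
    by rewrite /k scalerDr VE; mx_field.
  have VkE : V = k - t^-1 *: (M - 1%:M) by rewrite /k addrK.
  (* Consistency of the two evolution equations with [M = Q P + const]: the
     factors multiplying [QP] are those met when each word containing [Q P]
     is rewritten through [M]. *)
  have eM : dM = W *m M + b *m t%:M - M *m k.
    apply: (scalerI t0); rewrite -dQP.
    mx_lin (eq_add (eq_add (congr1 (mulmx^~ P) eQ) (congr1 (mulmx Q) eP))
      (eq_add (eq_add (esym X12E) (congr1 (mulmx M) kE))
        (eq_add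
          (congr1 (mulmx^~ (P - M - (t *: W + t *: Q + Theta - thi1%:M))) QP)
          (congr1 (mulmx (t *: W + t *: Q + Theta - thi1%:M)) QP)))).
  have eQk : dQ = (1%:M - Q) *m W + t^-1 *: Z - k *m (1%:M - Q).
    apply: (scalerI t0).
    mx_lin (eq_add eQ (congr1 (mulmx^~ (1%:M - Q)) kE)).
  split.
    exists k; rewrite !mul_col_mx !mul_mx_row !opp_col_mx !opp_row_mx.
    rewrite !add_col_mx !add_row_mx; split; [congr col_mx|congr row_mx].
    + exact: eM.
    + by rewrite VkE; mx_field.
    + by rewrite eQk; mx_field.
    + rewrite VkE; mx_lin (congr1 ( *:%R t^-1)
        (eq_add (congr1 (mulmx^~ M) eQk) (congr1 (mulmx (Q - 1%:M)) eM))).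
  exists h.
  have dR1E : dR1 = h *m R1 - row_mx (1%:M *m W + t^-1 *: N *m 1%:M)
      (1%:M *m b + t^-1 *: N *m (V - 1%:M)).
    rewrite !mul_mx_row !opp_row_mx !add_row_mx; congr row_mx.
    + by rewrite /h; mx_field.
    + rewrite /h; mx_lin (congr1 ( *:%R (t ^- 2))
        (eq_add (eq_add eP (congr1 ( *:%R t) (esym eM)))
          (eq_add (congr1 (mulmx M) kE) (congr1 (mulmx N) VE)))).
  split; last exact: dR1E.
  have eQh : Q + t *: dQ = 1%:M *m T + (V - 1%:M) *m (t *: Q) - t *: Q *m h.
    rewrite /h; mx_lin (eq_add eQ (eq_add (congr1 (mulmx^~ Q) (esym VE)) QP)).
  rewrite mul_col_mx opp_col_mx add_col_mx; congr col_mx; last exact: eQh.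
  (* Since [dR1] and the lower block of [dL1] are already of the right form,
     differentiating [R1 *m L1 = th1] leaves no freedom for the upper block. *)
  have e1 := R1L1; have e2 := dR1L1.
  rewrite dR1E mulmxBl -mulmxA e1 !mul_row_col eQh in e2.
  rewrite mul_row_col in e1.
  mx_lin (eq_add e2 (congr1 (mulmx^~ h) e1)).
Qed.
End MatrixPainleve.

(** * Two by two matrices and the Hamiltonian *)

(** The scalar analogue of [mx_lin]. *)
Ltac lin e := by apply: (eq_from_sub e); field; rewrite ?pnatr_eq0.

Section Entries.
Context {K : numFieldType}.

Lemma mx22_inj (a b c d a' b' c' d' : K) :
  mx22 a b c d = mx22 a' b' c' d' <-> [/\ a = a', b = b', c = c' & d = d'].
Proof.
split=> [/matrixP e|[-> -> -> ->]//].
by split; [have := e 0 0|have := e 0 1|have := e 1 0|have := e 1 1]; rewrite !mxE.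
Qed.

Lemma mx22_eta (A : 'M[K]_2) : A = mx22 (A 0 0) (A 0 1) (A 1 0) (A 1 1).
Proof.
apply/matrixP => i j; rewrite mxE.
have ord2 (k : 'I_2) : k = 0 \/ k = 1.
  by case: k => [[|[|k]] ltk] //; [left|right]; apply: val_inj.
by case: (ord2 i) => ->; case: (ord2 j) => ->.
Qed.

Lemma mx22D (a b c d a' b' c' d' : K) :
  mx22 a b c d + mx22 a' b' c' d' = mx22 (a + a') (b + b') (c + c') (d + d').
Proof. by apply/matrixP => i j; rewrite !mxE; case: ifP; case: ifP. Qed.

Lemma mx22N (a b c d : K) : - mx22 a b c d = mx22 (- a) (- b) (- c) (- d).
Proof. by apply/matrixP => i j; rewrite !mxE; case: ifP; case: ifP. Qed.

Lemma mx22Z (k a b c d : K) :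
  k *: mx22 a b c d = mx22 (k * a) (k * b) (k * c) (k * d).
Proof. by apply/matrixP => i j; rewrite !mxE; case: ifP; case: ifP. Qed.

Lemma mx22M (a b c d a' b' c' d' : K) :
  mx22 a b c d *m mx22 a' b' c' d' =
  mx22 (a * a' + b * c') (a * b' + b * d') (c * a' + d * c') (c * b' + d * d').
Proof.
apply/matrixP => i j; rewrite !mxE !big_ord_recl big_ord0 addr0 !mxE /=.
by case: ifP; case: ifP.
Qed.

Lemma mx22_scalar (k : K) : k%:M = mx22 k 0 0 k.
Proof.
by rewrite [LHS]mx22_eta !mxE.
Qed.

Lemma mx22_tr (a b c d : K) : \tr (mx22 a b c d) = a + d.
Proof. by rewrite /mxtrace !big_ord_recl big_ord0 addr0 !mxE. Qed.

Definition mx22E := (mx22_scalar, mx22M, mx22Z, mx22N, mx22D).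

Lemma HamE (th0 th1 thi1 thi2 q1 p1 q2 p2 t : K) : t != 0 ->
  t * Ham th0 th1 thi1 thi2 q1 p1 q2 p2 t =
  2 * (q1 ^+ 2 - q2 - q1) * (p1 ^+ 2 / 4 - p2 * (p2 * q2 - (th0 + th1 + thi1 + thi2)))
  + (2 * q1 - 1) * p1 * (2 * p2 * q2 - (th0 + th1 + thi1 + thi2))
  + t * ((q1 ^+ 2 - q2 - q1) * p1
         + (2 * q1 - 1) * (2 * p2 * q2 - (th0 + th1 + thi1 + thi2)))
  + (th0 - th1) * (q1 * p1 + 2 * p2 * q2 - (th0 + th1 + thi1 + thi2))
  + th1 * p1 + 2 * (th0 + thi1) * t * q1.
Proof.
move=> t0; rewrite /Ham /Qmx /Pmx !mx22E mx22_tr; field.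
by rewrite t0 ?pnatr_eq0.
Qed.

(** The Hamiltonian is quadratic in each of its four variables separately, so
    this is the only differentiation rule it needs. *)
Lemma derive1_quadratic (f : K -> K) (a b c y : K) :
  (forall z, f z = a * z ^+ 2 + b * z + c) -> derive1 f y = 2 * a * y + b.
Proof.
move=> fE; rewrite derive1E (_ : f = fun z => a * (z * z) + b * z + c).
  have hc (k : K) : is_derive y 1 (fun=> k) 0 by exact: is_derive_const.
  have hv : is_derive y 1 (fun z : K => z) 1 by exact: is_derive_var.
  have := is_derive_add (is_derive_add (is_derive_mul (hc a) (is_derive_mul hv hv))
    (is_derive_mul (hc b) hv)) (hc c).
  by case=> _ ->; ring.
by apply/funext => z; rewrite fE expr2.
Qed.

Section HamiltonianGradient.
Variables (th0 th1 thi1 thi2 q1 p1 q2 p2 t : K).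
Hypothesis t0 : t != 0.
Local Notation H := (Ham th0 th1 thi1 thi2).
Local Notation s := (th0 + th1 + thi1 + thi2).

Let HE x y z w : H x y z w t = (t * H x y z w t) / t.
Proof. by rewrite mulrC mulKf. Qed.

Lemma dHam_dp1 :
  t * derive1 (fun y => H q1 y q2 p2 t) p1 =
  (q1 ^+ 2 - q2 - q1) * p1 + (2 * q1 - 1) * (2 * p2 * q2 - s)
  + t * (q1 ^+ 2 - q2 - q1) + (th0 - th1) * q1 + th1.
Proof.
rewrite (@derive1_quadratic _
  ((q1 ^+ 2 - q2 - q1) / 2 / t)
  (((2 * q1 - 1) * (2 * p2 * q2 - s) + t * (q1 ^+ 2 - q2 - q1)
    + (th0 - th1) * q1 + th1) / t)
  ((- 2 * (q1 ^+ 2 - q2 - q1) * p2 * (p2 * q2 - s)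
    + t * (2 * q1 - 1) * (2 * p2 * q2 - s)
    + (th0 - th1) * (2 * p2 * q2 - s) + 2 * (th0 + thi1) * t * q1) / t)).
  by field; rewrite t0 ?pnatr_eq0.
by move=> z; rewrite HE HamE//; field; rewrite t0 ?pnatr_eq0.
Qed.

Lemma dHam_dq1 :
  t * derive1 (fun y => H y p1 q2 p2 t) q1 =
  (2 * q1 - 1) * (p1 ^+ 2 / 2 - 2 * p2 * (p2 * q2 - s))
  + 2 * p1 * (2 * p2 * q2 - s)
  + t * ((2 * q1 - 1) * p1 + 2 * (2 * p2 * q2 - s))
  + (th0 - th1) * p1 + 2 * (th0 + thi1) * t.
Proof.
rewrite (@derive1_quadratic _
  ((2 * (p1 ^+ 2 / 4 - p2 * (p2 * q2 - s)) + t * p1) / t)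
  ((- 2 * (p1 ^+ 2 / 4 - p2 * (p2 * q2 - s)) + 2 * p1 * (2 * p2 * q2 - s)
    + t * (- p1 + 2 * (2 * p2 * q2 - s))
    + (th0 - th1) * p1 + 2 * (th0 + thi1) * t) / t)
  ((- 2 * q2 * (p1 ^+ 2 / 4 - p2 * (p2 * q2 - s)) - p1 * (2 * p2 * q2 - s)
    + t * (- q2 * p1 - (2 * p2 * q2 - s))
    + (th0 - th1) * (2 * p2 * q2 - s) + th1 * p1) / t)).
  by field; rewrite t0 ?pnatr_eq0.
by move=> z; rewrite HE HamE//; field; rewrite t0 ?pnatr_eq0.
Qed.

Lemma dHam_dp2 :
  t * derive1 (fun y => H q1 p1 q2 y t) p2 =
  - 2 * (q1 ^+ 2 - q2 - q1) * (2 * p2 * q2 - s)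
  + 2 * (2 * q1 - 1) * q2 * (p1 + t) + 2 * (th0 - th1) * q2.
Proof.
rewrite (@derive1_quadratic _
  (- 2 * (q1 ^+ 2 - q2 - q1) * q2 / t)
  ((2 * (q1 ^+ 2 - q2 - q1) * s + 2 * (2 * q1 - 1) * q2 * (p1 + t)
    + 2 * (th0 - th1) * q2) / t)
  (((q1 ^+ 2 - q2 - q1) * p1 ^+ 2 / 2 - (2 * q1 - 1) * p1 * s
    + t * ((q1 ^+ 2 - q2 - q1) * p1 - (2 * q1 - 1) * s)
    + (th0 - th1) * (q1 * p1 - s) + th1 * p1 + 2 * (th0 + thi1) * t * q1) / t)).
  by field; rewrite t0 ?pnatr_eq0.
by move=> z; rewrite HE HamE//; field; rewrite t0 ?pnatr_eq0.
Qed.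

Lemma dHam_dq2 :
  t * derive1 (fun y => H q1 p1 y p2 t) q2 =
  - (p1 ^+ 2 / 2 - 2 * p2 * (p2 * q2 - s))
  - 2 * (q1 ^+ 2 - q2 - q1) * p2 ^+ 2 + 2 * (2 * q1 - 1) * p1 * p2
  + t * (- p1 + 2 * (2 * q1 - 1) * p2) + 2 * (th0 - th1) * p2.
Proof.
rewrite (@derive1_quadratic _
  (2 * p2 ^+ 2 / t)
  ((- (p1 ^+ 2 / 2 + 2 * p2 * s)
    - 2 * (q1 ^+ 2 - q1) * p2 ^+ 2 + 2 * (2 * q1 - 1) * p1 * p2
    + t * (- p1 + 2 * (2 * q1 - 1) * p2) + 2 * (th0 - th1) * p2) / t)
  ((2 * (q1 ^+ 2 - q1) * (p1 ^+ 2 / 4 + p2 * s) - (2 * q1 - 1) * p1 * s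
    + t * ((q1 ^+ 2 - q1) * p1 - (2 * q1 - 1) * s)
    + (th0 - th1) * (q1 * p1 - s) + th1 * p1 + 2 * (th0 + thi1) * t * q1) / t)).
  by field; rewrite t0 ?pnatr_eq0.
by move=> z; rewrite HE HamE//; field; rewrite t0 ?pnatr_eq0.
Qed.

End HamiltonianGradient.

Section Hamilton.
Variables (th0 th1 thi1 thi2 thi3 q1 p1 q2 p2 t dq1 dp1 dq2 dp2 w : K).
Variable V : 'M[K]_2.
Hypothesis fuchs : 2 * th0 + 2 * th1 + 2 * thi1 + thi2 + thi3 = 0.

Local Notation Q := (Qmx q1 q2).
Local Notation P := (Pmx th0 th1 thi1 thi2 p1 q2 p2).
Local Notation M := (Q *m P + (th0 + thi1)%:M).
Local Notation Theta := (Thetamx thi2 thi3).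
Local Notation W := (mx22 0 0 0 w).
Local Notation dQ := (mx22 dq1 0 (- dq2) dq1).
Local Notation dP := (mx22 (dp1 / 2) (- dp2) (dp2 * q2 + p2 * dq2) (dp1 / 2)).
Local Notation s := (th0 + th1 + thi1 + thi2).

(** This is where the trace condition on the exponents enters. *)
Lemma comm_PmxQmx : P *m Q = M + Theta + th1%:M.
Proof.
have -> : thi3 = - (2 * th0 + 2 * th1 + 2 * thi1 + thi2).
  by apply/eqP; rewrite -addr_eq0 addrC fuchs.
by rewrite /Thetamx /Qmx /Pmx !mx22E; apply/mx22_inj; split; field; rewrite ?pnatr_eq0.
Qed.

(** The derivative of [comm_PmxQmx]. *)
Lemma dcomm_PmxQmx : dP *m Q + P *m dQ = dQ *m P + Q *m dP.
Proof.
by rewrite /Qmx /Pmx !mx22E; apply/mx22_inj; split; field; rewrite ?pnatr_eq0.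
Qed.

(** The entry [(1, 2)] of the equation for [dQ], whose left-hand side vanishes,
    yields [t * w].  Of the other entries, one each for [dq1], [dq2], [dp1],
    [dp2] is used; the rest follow from these. *)
Lemma matrix_painleve_entries :
  [/\ t *: V = t *: W + (1%:M + t *: Q + Theta - thi1%:M),
      t *: dQ = t *: (W *m Q - Q *m W)
        + (M *m Q + Q *m M - M - M + (th0 + thi1)%:M - Theta
           + t *: (Q *m (Q - 1%:M)) + (Theta - thi1%:M) *m Q)
    & t *: dP = t *: (W *m P - P *m W)
        + (P *m P - P *m M - M *m P + t *: (P - M)
           - P *m (t *: Q + Theta - thi1%:M))] <->
  [/\ [/\ t * dq1 = (q1 ^+ 2 - q2 - q1) * p1 + (2 * q1 - 1) * (2 * p2 * q2 - s)
            + t * (q1 ^+ 2 - q2 - q1) + (th0 - th1) * q1 + th1,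
          t * dp1 = - ((2 * q1 - 1) * (p1 ^+ 2 / 2 - 2 * p2 * (p2 * q2 - s))
            + 2 * p1 * (2 * p2 * q2 - s)
            + t * ((2 * q1 - 1) * p1 + 2 * (2 * p2 * q2 - s))
            + (th0 - th1) * p1 + 2 * (th0 + thi1) * t),
          t * dq2 = - 2 * (q1 ^+ 2 - q2 - q1) * (2 * p2 * q2 - s)
            + 2 * (2 * q1 - 1) * q2 * (p1 + t) + 2 * (th0 - th1) * q2
        & t * dp2 = - (- (p1 ^+ 2 / 2 - 2 * p2 * (p2 * q2 - s))
            - 2 * (q1 ^+ 2 - q2 - q1) * p2 ^+ 2 + 2 * (2 * q1 - 1) * p1 * p2
            + t * (- p1 + 2 * (2 * q1 - 1) * p2) + 2 * (th0 - th1) * p2)],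
      t *: V = mx22 (t * q1 - thi1 + thi2 + 1) t (- (t * q2))
        (t * w + t * q1 - thi1 + thi3 + 1)
    & t * w = (2 * q1 - 1) * p1 - 2 * q1 * p2 * (q1 - 1)
        + 2 * t * q1 + 2 * p2 * q2 - t + th0 - th1].
Proof.
have -> : thi3 = - (2 * th0 + 2 * th1 + 2 * thi1 + thi2).
  by apply/eqP; rewrite -addr_eq0 addrC fuchs.
have VE : t *: W + (1%:M + t *: Q
    + Thetamx thi2 (- (2 * th0 + 2 * th1 + 2 * thi1 + thi2)) - thi1%:M) =
    mx22 (t * q1 - thi1 + thi2 + 1) t (- (t * q2))
      (t * w + t * q1 - thi1 - (2 * th0 + 2 * th1 + 2 * thi1 + thi2) + 1).
  by rewrite /Thetamx /Qmx !mx22E; apply/mx22_inj; split; ring.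
rewrite {}VE /Thetamx /Qmx /Pmx !mx22E.
split.
  move=> [-> /mx22_inj[e1 ew e2 _] /mx22_inj[e3 e4 _ _]].
  have wE : t * w = (2 * q1 - 1) * p1 - 2 * q1 * p2 * (q1 - 1)
        + 2 * t * q1 + 2 * p2 * q2 - t + th0 - th1 by lin ew.
  split=> //; split.
  + lin e1.
  + lin (eq_add e3 e3).
  + lin (eq_add (esym e2) (congr1 (fun x : K => x * q2) wE)).
  + lin (eq_add (esym e4) (congr1 (fun x : K => x * p2) (esym wE))).
move=> [[e1 e3 e2 e4] -> wE]; split=> //; apply/mx22_inj; split.
- lin e1.
- lin wE.
- lin (eq_add (esym e2) (congr1 (fun x : K => x * q2) wE)).
- lin e1.
- lin (congr1 (fun x : K => x / 2) e3).
- lin (eq_add (esym e4) (congr1 (fun x : K => x * p2) (esym wE))).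
- lin (eq_add (eq_add (congr1 (fun x : K => x * q2) e4)
    (congr1 (fun x : K => x * p2) e2))
    (congr1 (fun x : K => x * (p2 * q2 - s)) (esym wE))).
- lin (congr1 (fun x : K => x / 2) e3).
Qed.

End Hamilton.
End Entries.

(** * The poles of the curvature *)

Lemma simple_poles_eq0 (K : numFieldType) m n (C0 C1 : 'M[K]_(m, n)) :
  (forall x : K, x != 0 -> x != 1 -> x^-1 *: C0 + (x - 1)^-1 *: C1 = 0) <->
  C0 = 0 /\ C1 = 0.
Proof.
split=> [h|[-> ->] x _ _]; last by rewrite !scaler0 addr0.
(* The points [2] and [-1] suffice to separate the two residues. *)
have e2 : 2^-1 *: C0 + C1 = 0.
  have := h 2; rewrite pnatr_eq0 (_ : 2 - 1 = 1 :> K); last by ring.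
  by rewrite invr1 scale1r eq_sym pnatr_eq1; apply.
have eN : - C0 - 2^-1 *: C1 = 0.
  have := h (- 1); rewrite oppr_eq0 oner_eq0 invrN invr1 scaleN1r.
  rewrite (_ : - 1 - 1 = - 2 :> K); last by ring.
  rewrite invrN scaleNr; apply=> //.
  by rewrite -subr_eq0 -opprD oppr_eq0 (pnatr_eq0 K 2).
split; apply/matrixP => i j.
- have := congr1 (fun A : 'M[K]_(m, n) => A i j) e2.
  have := congr1 (fun A : 'M[K]_(m, n) => A i j) eN.
  rewrite !mxE => f1 f2; lin (eq_add (congr1 (fun x : K => x * - (4 / 3)) f1)
    (congr1 (fun x : K => x * - (2 / 3)) f2)).
- have := congr1 (fun A : 'M[K]_(m, n) => A i j) e2.
  have := congr1 (fun A : 'M[K]_(m, n) => A i j) eN.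
  rewrite !mxE => f1 f2; lin (eq_add (congr1 (fun x : K => x * (2 / 3)) f1)
    (congr1 (fun x : K => x * (4 / 3)) f2)).
Qed.

(** Multiplying [A0 / x] and [A1 / (x - 1)] by [- x *: E] produces a part
    constant in [x], which the hypothesis on [B1] cancels against the commutator
    of [- t *: E] with [B1]; the pole at [1] keeps an extra [- E]. *)
Lemma curvature_poles (K : fieldType) n (A0 A1 dA0 dA1 B1 Om E : 'M[K]_n)
    (x t : K) : x != 0 -> x - 1 != 0 ->
  E *m (A0 + A1) - (A0 + A1) *m E = t *: (E *m B1 - B1 *m E) ->
  let Rx := x^-1 *: A0 + (x - 1)^-1 *: A1 in
  let Ax := - t *: E + Rx in let Bx := - x *: E + B1 in
  x^-1 *: dA0 + (x - 1)^-1 *: dA1 + (Rx *m Om - Om *m Rx)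
    + (Ax *m Bx - Bx *m Ax) =
  x^-1 *: (dA0 - ((B1 + Om) *m A0 - A0 *m (B1 + Om))) +
  (x - 1)^-1 *: (dA1 - ((B1 + Om - E) *m A1 - A1 *m (B1 + Om - E))).
Proof.
move=> x0 x1 hE Rx Ax Bx; rewrite /Ax /Bx /Rx.
by apply: (eq_from_sub hE); mx_field; rewrite x0 x1.
Qed.

(** The derivative of a conjugate [Gi *m R *m G] is the conjugate of
    [dR + [R, Om]]. *)
Lemma gauge_curvature (K : fieldType) n (G Gi dG R dR E Ax Bx : 'M[K]_n) :
  Gi *m G = 1%:M -> G *m Gi = 1%:M ->
  let Om := dG *m Gi in
  (- E + ((- (Gi *m dG *m Gi) *m R + Gi *m dR) *m G + Gi *m R *m dG)) - (- E)
   + ((Gi *m Ax *m G) *m (Gi *m Bx *m G) - (Gi *m Bx *m G) *m (Gi *m Ax *m G)) =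
  Gi *m (dR + (R *m Om - Om *m R) + (Ax *m Bx - Bx *m Ax)) *m G.
Proof.
move=> GiG GGi Om; rewrite /Om.
have conjM (Y Z : 'M[K]_n) : (Gi *m Y *m G) *m (Gi *m Z *m G) = Gi *m (Y *m Z) *m G.
  by rewrite !mulmxA -(mulmxA _ G Gi) GGi mulmx1.
by rewrite !conjM -[Gi *m R *m dG]mulmx1 -GiG; mx_ring.
Qed.

Lemma curvature_gauged (K : numFieldType) n (G dG A0 A1 dA0 dA1 B1 X E : 'M[K]_n)
    (x t : K) : x != 0 -> x - 1 != 0 -> G \in unitmx ->
  E *m (A0 + A1) - (A0 + A1) *m E = t *: (E *m B1 - B1 *m E) ->
  B1 + dG *m invmx G = X ->
  (- E + ((- (invmx G *m dG *m invmx G) *m (x^-1 *: A0 + (x - 1)^-1 *: A1)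
       + invmx G *m (x^-1 *: dA0 + (x - 1)^-1 *: dA1)) *m G
       + invmx G *m (x^-1 *: A0 + (x - 1)^-1 *: A1) *m dG)) - (- E)
   + ((invmx G *m (- t *: E + (x^-1 *: A0 + (x - 1)^-1 *: A1)) *m G)
        *m (invmx G *m (- x *: E + B1) *m G)
      - (invmx G *m (- x *: E + B1) *m G)
        *m (invmx G *m (- t *: E + (x^-1 *: A0 + (x - 1)^-1 *: A1)) *m G)) =
  invmx G *m
    (x^-1 *: (dA0 - (X *m A0 - A0 *m X))
     + (x - 1)^-1 *: (dA1 - ((X - E) *m A1 - A1 *m (X - E)))) *m G.
Proof.
move=> x0 x1 uG hE <-; rewrite gauge_curvature ?mulVmx ?mulmxV//.
by rewrite (curvature_poles _ _ _ x0 x1 hE).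
Qed.

(** * The isomonodromic deformation *)

(** The second factor in the definition is expressed through [M]. *)
Lemma A0hat_factor (K : fieldType) (th0 th1 thi1 thi2 q1 p1 q2 p2 t : K) :
  let Q := Qmx q1 q2 in
  let M := Q *m Pmx th0 th1 thi1 thi2 p1 q2 p2 + (th0 + thi1)%:M in
  A0hat th0 th1 thi1 thi2 q1 p1 q2 p2 t =
  col_mx M t%:M *m
  row_mx (1%:M - Q) (t^-1 *: ((Q - 1%:M) *m M + th0%:M)).
Proof.
rewrite /A0hat /=; set Q := Qmx _ _; set P := Pmx _ _ _ _ _ _ _.
by congr (_ *m row_mx _ (_ *: _)); mx_ring.
Qed.

(** By [comm_PmxQmx] the inverse of [Q] disappears. *)
Lemma A1hat_factor (K : numFieldType) (th0 th1 thi1 thi2 thi3 q1 p1 q2 p2 t : K) :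
  2 * th0 + 2 * th1 + 2 * thi1 + thi2 + thi3 = 0 ->
  \det (Qmx q1 q2) != 0 ->
  let Q := Qmx q1 q2 in let P := Pmx th0 th1 thi1 thi2 p1 q2 p2 in
  let M := Q *m P + (th0 + thi1)%:M in
  A1hat th0 th1 thi1 thi2 thi3 q1 p1 q2 p2 t =
  col_mx (M *m (Q - 1%:M) - Thetamx thi2 thi3) (t *: Q) *m
  row_mx 1%:M (t^-1 *: (P - M)).
Proof.
move=> fuchs detQ; have uQ : Qmx q1 q2 \in unitmx by rewrite unitmxE unitfE.
have comm := comm_PmxQmx q1 p1 q2 p2 fuchs.
rewrite /A1hat /=.
rewrite (_ : _ + _ + Thetamx _ _ = Pmx th0 th1 thi1 thi2 p1 q2 p2 *m Qmx q1 q2).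
  by rewrite mulmxK// opprD addrA.
rewrite comm (_ : (th0 + th1 + thi1)%:M = (th0 + thi1)%:M + th1%:M); last first.
  by rewrite -raddfD /= addrAC.
by rewrite addrA; exact: addrAC.
Qed.

Section Compatibility.
Context {K : numFieldType}.
Variables (th0 th1 thi1 thi2 thi3 : K) (D : set K).
Variables (q1 p1 q2 p2 v : K -> K) (U : K -> 'M[K]_2).
Hypothesis fuchs : 2 * th0 + 2 * th1 + 2 * thi1 + thi2 + thi3 = 0.
Hypotheses (th0_neq0 : th0 != 0) (th1_neq0 : th1 != 0).
Hypotheses (oD : open D) (D_neq0 : ~ D 0).
Hypotheses (hol_q1 : holomorphic_on D q1) (hol_p1 : holomorphic_on D p1).
Hypotheses (hol_q2 : holomorphic_on D q2) (hol_p2 : holomorphic_on D p2).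
Hypotheses (hol_v : holomorphic_on D v) (hol_U : holomorphic_on D U).
Hypothesis v_neq0 : forall t, D t -> v t != 0.
Hypothesis detU_neq0 : forall t, D t -> \det (U t) != 0.
Hypothesis detQ_neq0 : forall t, D t -> \det (Qmx (q1 t) (q2 t)) != 0.
Variable t : K.
Hypothesis Dt : D t.

Local Notation Q s := (Qmx (q1 s) (q2 s)).
Local Notation P s := (Pmx th0 th1 thi1 thi2 (p1 s) (q2 s) (p2 s)).
Local Notation M s := (Q s *m P s + (th0 + thi1)%:M).
Local Notation Theta := (Thetamx thi2 thi3).
Local Notation A0 s := (A0hat th0 th1 thi1 thi2 (q1 s) (p1 s) (q2 s) (p2 s) s).
Local Notation A1 s := (A1hat th0 th1 thi1 thi2 thi3 (q1 s) (p1 s) (q2 s) (p2 s) s).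
Local Notation G s := (Gmx (v s) (U s)).
Local Notation E := (block_mx 0 0 0 1%:M : 'M[K]_(2 + 2)).

Local Notation dQ := (mx22 (derive1 q1 t) 0 (- derive1 q2 t) (derive1 q1 t)).
Local Notation dP := (mx22 (derive1 p1 t / 2) (- derive1 p2 t)
  (derive1 p2 t * q2 t + p2 t * derive1 q2 t) (derive1 p1 t / 2)).
Local Notation dM := (dQ *m P t + Q t *m dP).
Local Notation dG := (block_mx (mx22 0 0 0 (derive1 v t)) 0 0 (derive1 U t)).

Local Notation L0 s := (col_mx (M s) s%:M).
Local Notation R0 s := (row_mx (1%:M - Q s)
  (s^-1 *: ((Q s - 1%:M) *m M s + th0%:M))).
Local Notation dL0 := (col_mx dM 1%:M).
Local Notation dR0 := (row_mx (- dQ)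
  (t^-1 *: (dQ *m M t + (Q t - 1%:M) *m dM)
   - t ^- 2 *: ((Q t - 1%:M) *m M t + th0%:M))).
Local Notation L1 s := (col_mx (M s *m (Q s - 1%:M) - Theta) (s *: Q s)).
Local Notation R1 s := (row_mx 1%:M (s^-1 *: (P s - M s))).
Local Notation dL1 := (col_mx (dM *m (Q t - 1%:M) + M t *m dQ) (Q t + t *: dQ)).
Local Notation dR1 := (row_mx (0 : 'M[K]_2)
  (t^-1 *: (dP - dM) - t ^- 2 *: (P t - M t))).

Let t0 : t != 0.
Proof. by apply/eqP => t0; apply: D_neq0; rewrite -t0. Qed.

Let nearD : \forall s \near t, D s.
Proof. exact: open_nbhs_nbhs. Qed.

Lemma is_derive_hol {V : normedModType K} (f : K -> V) :
  holomorphic_on D f -> is_derive t 1 f (derive1 f t).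
Proof. by move=> /(_ _ Dt) hf; rewrite derive1E; exact: derivableP. Qed.

Let dq1 := is_derive_hol hol_q1.
Let dp1 := is_derive_hol hol_p1.
Let dq2 := is_derive_hol hol_q2.
Let dp2 := is_derive_hol hol_p2.

Lemma is_derive_Q : is_derive t 1 (fun s => Q s) dQ.
Proof.
by apply: is_derive_mx22 => //; exact: is_derive_opp.
Qed.

Lemma is_derive_P : is_derive t 1 (fun s => P s) dP.
Proof.
have half : is_derive t 1 (fun s => p1 s / 2) (derive1 p1 t / 2).
  apply: (is_derive_ext (is_derive_mul dp1 (is_derive_constK 2^-1 t)) _).
  by rewrite mulr0 addr0.
have low : is_derive t 1 (fun s => p2 s * q2 s - th0 - th1 - thi1 - thi2)
    (derive1 p2 t * q2 t + p2 t * derive1 q2 t).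
  apply: (is_derive_ext (is_derive_add (is_derive_add (is_derive_add
    (is_derive_add (is_derive_mul dp2 dq2) (is_derive_constK _ t))
    (is_derive_constK _ t)) (is_derive_constK _ t)) (is_derive_constK _ t)) _).
  by rewrite !addr0.
by apply: is_derive_mx22 => //; exact: is_derive_opp.
Qed.

Lemma is_derive_M : is_derive t 1 (fun s => M s) dM.
Proof.
apply: (is_derive_ext (is_derive_add (is_derive_mulmx is_derive_Q is_derive_P)
  (is_derive_const _ t)) _).
by rewrite addr0.
Qed.

Lemma is_derive_invZ (F : K -> 'M[K]_2) dF : is_derive t 1 F dF ->
  is_derive t 1 (fun s => s^-1 *: F s) (t^-1 *: dF - t ^- 2 *: F t).
Proof.
move=> hF.
apply: (is_derive_ext
  (is_derive_scalemx (is_derive_inv t0 (is_derive_var t)) hF) _).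
by rewrite mulr1 scaleNr addrC.
Qed.

Lemma is_derive_L0 : is_derive t 1 (fun s => L0 s) dL0.
Proof.
apply: is_derive_col_mx; first exact: is_derive_M.
exact: (is_derive_scalar_mx _ (is_derive_var t)).
Qed.

Lemma is_derive_Q1 : is_derive t 1 (fun s => Q s - 1%:M) dQ.
Proof.
apply: (is_derive_ext (is_derive_add is_derive_Q (is_derive_const _ t)) _).
exact: addr0.
Qed.

Lemma is_derive_R0 : is_derive t 1 (fun s => R0 s) dR0.
Proof.
apply: is_derive_row_mx.
  apply: (is_derive_ext
    (is_derive_add (is_derive_const _ t) (is_derive_opp is_derive_Q)) _).
  exact: add0r.
apply: is_derive_invZ.
apply: (is_derive_ext (is_derive_add (is_derive_mulmx is_derive_Q1 is_derive_M)
  (is_derive_const _ t)) _).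
exact: addr0.
Qed.

Lemma is_derive_L1 : is_derive t 1 (fun s => L1 s) dL1.
Proof.
apply: is_derive_col_mx.
  apply: (is_derive_ext (is_derive_add (is_derive_mulmx is_derive_M is_derive_Q1)
    (is_derive_const _ t)) _).
  exact: addr0.
apply: (is_derive_ext (is_derive_scalemx (is_derive_var t) is_derive_Q) _).
by rewrite scale1r.
Qed.

Lemma is_derive_R1 : is_derive t 1 (fun s => R1 s) dR1.
Proof.
apply: (is_derive_row_mx (is_derive_const _ t)); apply: is_derive_invZ.
exact: (is_derive_add is_derive_P (is_derive_opp is_derive_M)).
Qed.

Lemma is_derive_A0 : is_derive t 1 (fun s => A0 s) (dL0 *m R0 t + L0 t *m dR0).
Proof.
rewrite (_ : (fun s => A0 s) = fun s => L0 s *m R0 s); last first.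
  by apply/funext => s; rewrite A0hat_factor.
exact: (is_derive_mulmx is_derive_L0 is_derive_R0).
Qed.

(** The factorisation needs [\det Q != 0], which is known near [t] because
    [D] is open. *)
Lemma is_derive_A1 : is_derive t 1 (fun s => A1 s) (dL1 *m R1 t + L1 t *m dR1).
Proof.
apply: (near_eq_is_derive (f := fun s => L1 s *m R1 s)).
  near=> s; rewrite A1hat_factor//; apply: detQ_neq0; near: s.
  exact: nearD.
exact: (is_derive_mulmx is_derive_L1 is_derive_R1).
Unshelve. all: by end_near. Qed.

Lemma mulmx_Gmx s : D s ->
  Gmx (v s)^-1 (invmx (U s)) *m G s = 1%:M.
Proof.
move=> Ds; have uU : U s \in unitmx by rewrite unitmxE unitfE detU_neq0.
rewrite /Gmx mulmx_block !mulmx0 !mul0mx !addr0 add0r mulVmx//.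
rewrite (_ : mx22 _ _ _ _ *m _ = 1%:M) -?scalar_mx_block//.
by rewrite !mx22E; apply/mx22_inj; split; field; rewrite ?v_neq0.
Qed.

Lemma Gmx_unit s : D s -> G s \in unitmx.
Proof. by move=> /mulmx_Gmx /mulmx1_unit []. Qed.

Lemma invmx_Gmx s : D s -> invmx (G s) = Gmx (v s)^-1 (invmx (U s)).
Proof.
move=> Ds; apply: (can_inj (mulmxK (Gmx_unit Ds))).
by rewrite mulVmx ?Gmx_unit// mulmx_Gmx.
Qed.

Lemma is_derive_G : is_derive t 1 (fun s => G s) dG.
Proof.
apply: is_derive_col_mx; apply: is_derive_row_mx.
- by apply: is_derive_mx22; exact: is_derive_hol.
- exact: is_derive_hol.
Qed.

Lemma is_derive_invG :
  is_derive t 1 (fun s => invmx (G s)) (- (invmx (G t) *m dG *m invmx (G t))).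
Proof.
apply: is_derive_invmx is_derive_G.
by near=> s; apply: Gmx_unit; near: s; exact: nearD.
Unshelve. all: by end_near. Qed.

Local Notation Om := (dG *m invmx (G t)).
Local Notation W := (mx22 0 0 0 (derive1 v t / v t)).
Local Notation V := (derive1 U t *m invmx (U t)).

Lemma OmE : Om = block_mx W 0 0 V.
Proof.
rewrite invmx_Gmx// /Gmx mulmx_block !mulmx0 !mul0mx !addr0 add0r.
congr block_mx; rewrite !mx22E; apply/mx22_inj; split; ring.
Qed.

Local Notation A x s := (Amx th0 th1 thi1 thi2 thi3
  (q1 s) (p1 s) (q2 s) (p2 s) (v s) (U s) x s).
Local Notation B x s := (Bmx th0 th1 thi1 thi2 thi3
  (q1 s) (p1 s) (q2 s) (p2 s) (v s) (U s) x s).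
Local Notation B1 := (B1hat th0 th1 thi1 thi2 thi3 (q1 t) (p1 t) (q2 t) (p2 t) t).
Local Notation dA0 := (dL0 *m R0 t + L0 t *m dR0).
Local Notation dA1 := (dL1 *m R1 t + L1 t *m dR1).
Local Notation Rx x s := (x^-1 *: A0 s + (x - 1)^-1 *: A1 s).

Lemma is_derive_A (x : K) : is_derive t 1 (fun s => A x s)
  (- E + ((- (invmx (G t) *m dG *m invmx (G t)) *m Rx x t
     + invmx (G t) *m (x^-1 *: dA0 + (x - 1)^-1 *: dA1)) *m G t
   + invmx (G t) *m Rx x t *m dG)).
Proof.
apply: is_derive_add.
  have -> : - E = block_mx 0 0 0 (- 1)%:M.
    by rewrite opp_block_mx !oppr0 raddfN.
  apply: is_derive_col_mx; apply: is_derive_row_mx.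
  by apply: is_derive_scalar_mx; apply: is_derive_opp; exact: is_derive_var.
apply: is_derive_mulmx; last exact: is_derive_G.
apply: is_derive_mulmx; first exact: is_derive_invG.
apply: is_derive_add.
  apply: (is_derive_ext (is_derive_scalemx (is_derive_constK _ t) is_derive_A0) _).
  by rewrite scale0r add0r.
apply: (is_derive_ext (is_derive_scalemx (is_derive_constK _ t) is_derive_A1) _).
by rewrite scale0r add0r.
Qed.

Lemma is_derive_B (x : K) : is_derive x 1 (fun y => B y t) (- E).
Proof.
apply: (is_derive_ext (is_derive_add (is_derive_opp (is_derive_scalemx
  (is_derive_var x) (is_derive_const (V := 'M[K]_(2 + 2)) E x)))
  (is_derive_const _ x)) _).
by rewrite scale1r scaler0 !addr0.
Qed.

Local Notation Z := ((Q t - 1%:M) *m M t + th0%:M).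
Local Notation T := (M t *m (Q t - 1%:M) - Theta).
Local Notation N := (P t - M t).
Local Notation S12 := (M t *m (t^-1 *: Z) + T *m (t^-1 *: N)).
Local Notation X := (block_mx W (t^-1 *: S12) 1%:M V).

(** The lower left block is [t (I - Q) + t Q]. *)
Lemma residue_sumE : exists S11 S22 : 'M[K]_2,
  A0 t + A1 t = block_mx S11 S12 t%:M S22.
Proof.
rewrite /= A0hat_factor A1hat_factor ?detQ_neq0//= !mul_col_row add_block_mx.
eexists; eexists; congr block_mx.
by rewrite mul_scalar_mx mulmx1 -scalerDr subrK scalemx1.
Qed.

Lemma B1E : B1 = block_mx 0 (t^-1 *: S12) 1%:M 0.
Proof.
rewrite /B1hat /=; have [S11 [S22 ->]] := residue_sumE.
rewrite block_mxKur block_mxKdl scale_block_mx !scaler0.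
by rewrite scale_scalar_mx mulVf.
Qed.

Lemma comm_E_residue_sum :
  E *m (A0 t + A1 t) - (A0 t + A1 t) *m E = t *: (E *m B1 - B1 *m E).
Proof.
rewrite B1E; have [S11 [S22 ->]] := residue_sumE.
rewrite !mulmx_block !mul0mx !mulmx0 !mul1mx !mulmx1 !addr0 !add0r.
rewrite !opp_block_mx !add_block_mx !scale_block_mx.
congr block_mx; rewrite ?oppr0 ?addr0 ?add0r ?subrr ?scaler0//.
- by rewrite scalerN scalerA mulfV// scale1r.
- by rewrite scalemx1.
Qed.

Lemma XE : B1 + Om = X.
Proof. by rewrite B1E OmE add_block_mx !add0r !addr0. Qed.

Lemma zero_curvatureE (x : K) : x != 0 -> x != 1 ->
  zero_curvature (fun x s => A x s) (fun x s => B x s) x t =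
  invmx (G t) *m
    (x^-1 *: (dA0 - (X *m A0 t - A0 t *m X))
     + (x - 1)^-1 *: (dA1 - ((X - E) *m A1 t - A1 t *m (X - E)))) *m G t.
Proof.
move=> x0 x1; rewrite -subr_eq0 in x1.
have uG := Gmx_unit Dt.
rewrite /zero_curvature.
rewrite (is_derive_derive1 (is_derive_A x)) (is_derive_derive1 (is_derive_B x)).
have EG : E *m Gmx (v t) (U t) = Gmx (v t) (U t) *m E.
  by rewrite !mulmx_block !(mul0mx, mulmx0, mul1mx, mulmx1) !(addr0, add0r).
have conjE (k : K) : invmx (G t) *m (k *: E) *m G t = k *: E.
  by rewrite -scalemxAr -scalemxAl -mulmxA EG mulKmx.
have AE : A x t = invmx (G t) *m (- t *: E + Rx x t) *m G t.
  rewrite mulmxDr mulmxDl conjE /Amx /=; congr (_ + _).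
  by rewrite /Ainf scale_block_mx !scaler0 scalemx1.
have BE : B x t = invmx (G t) *m (- x *: E + B1) *m G t.
  by rewrite mulmxDr mulmxDl conjE /Bmx /= scaleNr.
rewrite AE BE.
exact: (curvature_gauged dA0 dA1 x0 x1 uG comm_E_residue_sum XE).
Qed.

Lemma zero_curvature_residues :
  (forall x, x != 0 -> x != 1 ->
    zero_curvature (fun x s => A x s) (fun x s => B x s) x t = 0) <->
  (dA0 = X *m (L0 t *m R0 t) - L0 t *m R0 t *m X /\
   dA1 = (X - E) *m (L1 t *m R1 t) - L1 t *m R1 t *m (X - E)).
Proof.
have uG := Gmx_unit Dt.
have A0E : A0 t = L0 t *m R0 t by rewrite /= A0hat_factor.
have A1E : A1 t = L1 t *m R1 t by rewrite /= A1hat_factor ?detQ_neq0.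
split=> [h|[h0 h1] x x0 x1]; last first.
  by rewrite zero_curvatureE// A0E A1E -h0 -h1 !subrr !scaler0 addr0 mulmx0 mul0mx.
have [h0 h1] : dA0 - (X *m A0 t - A0 t *m X) = 0 /\
    dA1 - ((X - E) *m A1 t - A1 t *m (X - E)) = 0.
  apply/simple_poles_eq0 => x x0 x1.
  have := h x x0 x1; rewrite zero_curvatureE// => /(congr1 (mulmx (G t))).
  rewrite mulmx0 -mulmxA mulKVmx// => /(congr1 (mulmx^~ (invmx (G t)))).
  by rewrite mul0mx mulmxK.
by rewrite -A0E -A1E; split; apply: subr0_eq.
Qed.

Lemma compatibility_at :
  (forall x, x != 0 -> x != 1 ->
    zero_curvature (fun x s => A x s) (fun x s => B x s) x t = 0) <->
  [/\ [/\ derive1 q1 t = derive1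
              (fun y => Ham th0 th1 thi1 thi2 (q1 t) y (q2 t) (p2 t) t) (p1 t),
           derive1 p1 t = - derive1
              (fun y => Ham th0 th1 thi1 thi2 y (p1 t) (q2 t) (p2 t) t) (q1 t),
           derive1 q2 t = derive1
              (fun y => Ham th0 th1 thi1 thi2 (q1 t) (p1 t) (q2 t) y t) (p2 t)
         & derive1 p2 t = - derive1
              (fun y => Ham th0 th1 thi1 thi2 (q1 t) (p1 t) y (p2 t) t) (q2 t)],
      t *: derive1 U t =
        mx22 (t * q1 t - thi1 + thi2 + 1)
             t
             (- (t * q2 t))
             (2 * p1 t * q1 t + 3 * t * q1 t - p1 t + 2 * p2 t * q2 t
              - 2 * q1 t * p2 t * (q1 t - 1)
              - (th0 + 3 * th1 + 3 * thi1 + thi2 - 1) - t) *m U t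
    & t / v t * derive1 v t =
        (2 * q1 t - 1) * p1 t - 2 * q1 t * p2 t * (q1 t - 1)
        + 2 * t * q1 t + 2 * p2 t * q2 t - t + th0 - th1].
Proof.
have uU : U t \in unitmx by rewrite unitmxE unitfE detU_neq0.
have bE : t *: (t^-1 *: S12) = S12 by rewrite scalerA mulfV// scale1r.
have QPE : Q t *m P t = M t - (th0 + thi1)%:M by rewrite addrK.
have res := @residues_matrix_painleve K 2 th0 th1 thi1 t Theta (Q t) (P t) (M t)
  dQ dP dM W V (t^-1 *: S12) t0 th0_neq0 th1_neq0 QPE erefl
  (comm_PmxQmx _ _ _ _ fuchs) (dcomm_PmxQmx _ _ _ _ _ _ _ _ _ _ _ _) bE.
apply: (iff_trans zero_curvature_residues); apply: (iff_trans res) => {res}.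
apply: (iff_trans (matrix_painleve_entries _ _ _ _ _ _ _ _ _ _ _ fuchs)).
rewrite -(dHam_dp1 _ _ _ _ _ _ _ _ t0) -(dHam_dq1 _ _ _ _ _ _ _ _ t0).
rewrite -(dHam_dp2 _ _ _ _ _ _ _ _ t0) -(dHam_dq2 _ _ _ _ _ _ _ _ t0).
have VE (A : 'M[K]_2) : t *: V = A <-> t *: derive1 U t = A *m U t.
  split=> [<-|e]; first by rewrite -scalemxAl mulmxKV.
  by rewrite scalemxAl e mulmxK.
have wE : t / v t * derive1 v t = t * (derive1 v t / v t) by rewrite mulrAC mulrA.
have U22 a b c : t * (derive1 v t / v t) = (2 * q1 t - 1) * p1 t
    - 2 * q1 t * p2 t * (q1 t - 1) + 2 * t * q1 t + 2 * p2 t * q2 t - t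
    + th0 - th1 ->
  mx22 a b c (t * (derive1 v t / v t) + t * q1 t - thi1 + thi3 + 1) =
  mx22 a b c (2 * p1 t * q1 t + 3 * t * q1 t - p1 t + 2 * p2 t * q2 t
    - 2 * q1 t * p2 t * (q1 t - 1) - (th0 + 3 * th1 + 3 * thi1 + thi2 - 1) - t).
  move: (t * _) => tw ew; apply/mx22_inj; split=> //.
  lin (eq_add ew fuchs).
rewrite wE; split.
  move=> [[e1 e2 e3 e4] /VE eV ew]; rewrite -(U22 _ _ _ ew).
  split; [|exact: eV|exact: ew].
  by split; apply: (mulfI t0); rewrite ?mulrN;
    [exact: e1|exact: e2|exact: e3|exact: e4].
move=> [[e1 e2 e3 e4] eU ew]; rewrite (U22 _ _ _ ew).
split; [|exact/VE|exact: ew].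
by split; [rewrite e1|rewrite e2 mulrN|rewrite e3|rewrite e4 mulrN].
Qed.

End Compatibility.

Theorem mainTheorem6 (R : realType) (th0 th1 thi1 thi2 thi3 : Cplx R)
    (D : set (Cplx R)) (q1 p1 q2 p2 v : Cplx R -> Cplx R)
    (U : Cplx R -> 'M[Cplx R]_2)
    (fuchs : 2 * th0 + 2 * th1 + 2 * thi1 + thi2 + thi3 = 0)
    (th0_neq0 : th0 != 0) (th1_neq0 : th1 != 0) (thi23 : thi2 != thi3)
    (domD : domain D) (D_neq0 : ~ D 0)
    (hol_q1 : holomorphic_on D q1) (hol_p1 : holomorphic_on D p1)
    (hol_q2 : holomorphic_on D q2) (hol_p2 : holomorphic_on D p2)
    (hol_v : holomorphic_on D v) (hol_U : holomorphic_on D U)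
    (v_neq0 : forall t, D t -> v t != 0)
    (detU_neq0 : forall t, D t -> \det (U t) != 0)
    (detQ_neq0 : forall t, D t -> \det (Qmx (q1 t) (q2 t)) != 0) :
  let A x t := Amx th0 th1 thi1 thi2 thi3
                 (q1 t) (p1 t) (q2 t) (p2 t) (v t) (U t) x t in
  let B x t := Bmx th0 th1 thi1 thi2 thi3
                 (q1 t) (p1 t) (q2 t) (p2 t) (v t) (U t) x t in
  let H := Ham th0 th1 thi1 thi2 in
  let eta := th0 + 3 * th1 + 3 * thi1 + thi2 - 1 in
  (forall t, D t -> forall x, x != 0 -> x != 1 -> zero_curvature A B x t = 0)
  <->
  (forall t, D t ->
    [/\ [/\ derive1 q1 t = derive1 (fun y => H (q1 t) y (q2 t) (p2 t) t) (p1 t),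
            derive1 p1 t = - derive1 (fun y => H y (p1 t) (q2 t) (p2 t) t) (q1 t),
            derive1 q2 t = derive1 (fun y => H (q1 t) (p1 t) (q2 t) y t) (p2 t)
          & derive1 p2 t = - derive1 (fun y => H (q1 t) (p1 t) y (p2 t) t) (q2 t)],
        t *: derive1 U t =
          mx22 (t * q1 t - thi1 + thi2 + 1)
               t
               (- (t * q2 t))
               (2 * p1 t * q1 t + 3 * t * q1 t - p1 t + 2 * p2 t * q2 t
                - 2 * q1 t * p2 t * (q1 t - 1) - eta - t) *m U t
      & t / v t * derive1 v t =
          (2 * q1 t - 1) * p1 t - 2 * q1 t * p2 t * (q1 t - 1)
          + 2 * t * q1 t + 2 * p2 t * q2 t - t + th0 - th1]).
Proof.
move: domD => [oD _ _] A B H eta.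
split=> h t Dt.
  exact/(compatibility_at fuchs th0_neq0 th1_neq0 oD D_neq0 hol_q1 hol_p1
    hol_q2 hol_p2 hol_v hol_U v_neq0 detU_neq0 detQ_neq0 Dt)/h.
exact/(compatibility_at fuchs th0_neq0 th1_neq0 oD D_neq0 hol_q1 hol_p1
  hol_q2 hol_p2 hol_v hol_U v_neq0 detU_neq0 detQ_neq0 Dt)/h.
Qed.
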